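(* For every finite group $G$ and every multiset $S\in\mathcal{C}(G)$, the Cayley multigraph $\mathrm{Cay}(G,S)$ is integral, i.e., all eigenvalues of its adjacency matrix are integers.
   Context: A multiset $S$ of elements of a finite group $G$ is given by its multiplicity function $\mu_S:G\to\mathbb{Z}_{\ge 0}$ (with $\mu_S(x)=0$ meaning $x\notin S$). It is inverse-closed if $\mu_S(s)=\mu_S(s^{-1})$ for all $s$. For an inverse-closed multiset $S$, the Cayley multigraph $\mathrm{Cay}(G,S)$ has vertex set $G$, and the number of edges joining $x$ and $y$ is $\mu_S(xy^{-1})$; its adjacency matrix is the $G\times G$ matrix with $(x,y)$ entry $\mu_S(xy^{-1})$. $\mathcal{B}(G)$ denotes the boolean algebra of subsets of $G$ generated by the normal subgroups of $G$ (all subsets obtained from normal subgroups by repeatedly taking unions, intersections and symmetric differences). An atom of $\mathcal{B}(G)$ is a minimal nonempty member of it. The integral cone $\mathcal{C}(G)$ is the collection of all multisets whose multiplicity function is a non-negative integer combination of the indicator functions of the atoms of $\mathcal{B}(G)$. (Such multisets are inverse-closed.) *)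

(* Defs.v *)
(* Plain MathComp. *)
From HB Require Import structures.
From mathcomp Require Import all_boot all_order all_algebra all_fingroup.

Set Implicit Arguments.
Unset Strict Implicit.
Unset Printing Implicit Defensive.

Import GRing.Theory.

Local Open Scope group_scope.

(* The ambient finite group is the whole of [gT], and a multiset of its
   elements is its multiplicity function [gT -> nat]. *)

Definition inverse_closed (gT : finGroupType) (mu : gT -> nat) : Prop :=
  forall s : gT, mu s = mu s^-1.

(* Complements need no constructor: [set: gT] is itself a normal subgroup. *)
Inductive normal_algebra (gT : finGroupType) : {set gT} -> Prop :=
| NormalAlgebraSubgroup (N : {group gT}) :
    N <| [set: gT] -> normal_algebra N
| NormalAlgebraUnion (A B : {set gT}) :
    normal_algebra A -> normal_algebra B -> normal_algebra (A :|: B)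
| NormalAlgebraInter (A B : {set gT}) :
    normal_algebra A -> normal_algebra B -> normal_algebra (A :&: B)
| NormalAlgebraSymDiff (A B : {set gT}) :
    normal_algebra A -> normal_algebra B ->
    normal_algebra ((A :\: B) :|: (B :\: A)).

Definition normal_atom (gT : finGroupType) (A : {set gT}) : Prop :=
  [/\ normal_algebra A, A != set0
    & forall B : {set gT},
        normal_algebra B -> B != set0 -> B \subset A -> B = A].

(* Being an atom is not a boolean predicate, so the sum ranges over all subsets
   and the coefficients are required to vanish off the atoms. *)
Definition integral_cone (gT : finGroupType) (mu : gT -> nat) : Prop :=
  exists2 c : {set gT} -> nat,
    forall A : {set gT}, c A != 0%N -> normal_atom A
  & forall x : gT, mu x = (\sum_(A : {set gT}) c A * (x \in A))%N.

Lemma normal_algebraV (gT : finGroupType) (A : {set gT}) (x : gT) :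
  normal_algebra A -> (x^-1 \in A) = (x \in A).
Proof.
by elim=> {A} [N _|A B _ IHA _ IHB|A B _ IHA _ IHB|A B _ IHA _ IHB];
  rewrite ?groupV // !inE IHA IHB.
Qed.

Lemma integral_cone_inverse_closed (gT : finGroupType) (mu : gT -> nat) :
  integral_cone mu -> inverse_closed mu.
Proof.
case=> c cP muE s; rewrite !muE; apply: eq_bigr => A _.
by have [->//|/cP[algA _ _]] := eqVneq (c A) 0%N; rewrite normal_algebraV.
Qed.

Definition cayley_edges (gT : finGroupType) (mu : gT -> nat) (x y : gT) : nat :=
  mu (x * y^-1).

(* Rows and columns are indexed by [gT] through its enumeration. *)
Definition cayley_adjacency (C : numClosedFieldType) (gT : finGroupType)
    (mu : gT -> nat) : 'M[C]_#|gT| :=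
  (\matrix_(i, j) (cayley_edges mu (enum_val i) (enum_val j))%:R)%R.

(* [C] plays the role of the field of complex numbers. *)
Definition integral_cayley (C : numClosedFieldType) (gT : finGroupType)
    (mu : gT -> nat) : Prop :=
  forall a : C, eigenvalue (cayley_adjacency C mu) a ->
    exists z : int, a = (z%:~R)%R.

(* Main.v *)
Require Import Defs.
From HB Require Import structures.
From mathcomp Require Import all_boot all_order all_algebra all_fingroup.

(** Write [J_f] for the matrix with entries [f (x y^-1)], and [J_N] when [f] is
    the indicator function of a normal subgroup [N].  Since normal subgroups
    are closed under intersection, the integer combinations of their indicator
    functions form a ring, so this ring contains the indicator function of
    every member of the boolean algebra they generate, and hence every
    multiplicity function in the integral cone
    ([integral_cone_normal_span]).

    It remains to see that [J_f] has only integer eigenvalues when [f] is such a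
    combination.  Counting the intersection of two cosets gives
    [J_N J_M = |N :&: M| J_(NM)] ([cayley_mxM]), so these matrices commute.  Given
    an eigenvector [v] of [J_f], let [N] be a maximal normal subgroup with
    [v J_N != 0]; one exists because [J_1] is the identity.  Put [w = v J_N],
    which is again an eigenvector of [J_f] for the same eigenvalue.  For a
    normal subgroup [M], either [M \subset N] and [w J_M = |M| w], or [NM] is
    strictly larger than [N] and [w J_M = |N :&: M| v J_(NM) = 0]
    ([maximal_common_eigenvector]).  So every [J_M], and therefore [J_f], acts on
    [w] as an integer. *)

Set Implicit Arguments.
Unset Strict Implicit.
Unset Printing Implicit Defensive.

Import GRing.Theory.

Local Open Scope group_scope.
Local Open Scope ring_scope.

Definition set_indicator (gT : finGroupType) (A : {set gT}) : {ffun gT -> int} :=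
  [ffun x => (x \in A)%:R].

Definition cayley_mx (F : fieldType) (gT : finGroupType)
    (f : {ffun gT -> int}) : 'M[F]_#|gT| :=
  \matrix_(i, j) (f (enum_val i * (enum_val j)^-1)%g)%:~R.

(** Subtraction alone generates all integer combinations, which keeps
    inductions over the span down to two cases. *)
Inductive normal_span (gT : finGroupType) : {ffun gT -> int} -> Prop :=
| NormalSpanSubgroup (N : {group gT}) :
    N <| [set: gT] -> normal_span (set_indicator N)
| NormalSpanSub (f g : {ffun gT -> int}) :
    normal_span f -> normal_span g -> normal_span (f - g).

Lemma set_indicatorI (gT : finGroupType) (A B : {set gT}) :
  set_indicator (A :&: B) = set_indicator A * set_indicator B.
Proof. by apply/ffunP=> x; rewrite !ffunE inE -natrM mulnb. Qed.

Lemma set_indicatorU (gT : finGroupType) (A B : {set gT}) :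
  set_indicator (A :|: B)
  = set_indicator A + set_indicator B - set_indicator (A :&: B).
Proof.
by apply/ffunP=> x; rewrite !ffunE !inE; case: (x \in A); case: (x \in B).
Qed.

Lemma set_indicator_symdiff (gT : finGroupType) (A B : {set gT}) :
  set_indicator ((A :\: B) :|: (B :\: A))
  = set_indicator (A :|: B) - set_indicator (A :&: B).
Proof.
by apply/ffunP=> x; rewrite !ffunE !inE; case: (x \in A); case: (x \in B).
Qed.

Lemma normal_span0 (gT : finGroupType) : normal_span (0 : {ffun gT -> int}).
Proof.
rewrite -(subrr (set_indicator [set: gT]%G)).
by apply: NormalSpanSub; apply: NormalSpanSubgroup.
Qed.

Lemma normal_spanD (gT : finGroupType) (f g : {ffun gT -> int}) :
  normal_span f -> normal_span g -> normal_span (f + g).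
Proof.
move=> spf spg; rewrite -[g]opprK -[- g]sub0r.
by do 2![apply: NormalSpanSub => //]; apply: normal_span0.
Qed.

Lemma normal_spanM (gT : finGroupType) (f g : {ffun gT -> int}) :
  normal_span f -> normal_span g -> normal_span (f * g).
Proof.
move=> spf spg; elim: spf => {f} [N nN | f1 f2 _ IH1 _ IH2]; last first.
  by rewrite mulrBl; apply: NormalSpanSub.
elim: spg => {g} [M nM | g1 g2 _ IH1 _ IH2]; last first.
  by rewrite mulrBr; apply: NormalSpanSub.
rewrite -set_indicatorI.
exact: (@NormalSpanSubgroup _ (N :&: M)%G (normalI nN nM)).
Qed.

Lemma normal_algebra_span (gT : finGroupType) (A : {set gT}) :
  normal_algebra A -> normal_span (set_indicator A).
Proof.
elim=> {A} [N nN | A B _ IHA _ IHB | A B _ IHA _ IHB | A B _ IHA _ IHB].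
- exact: NormalSpanSubgroup.
- rewrite set_indicatorU set_indicatorI.
  by apply: NormalSpanSub; [apply: normal_spanD | apply: normal_spanM].
- by rewrite set_indicatorI; apply: normal_spanM.
rewrite set_indicator_symdiff set_indicatorU set_indicatorI.
have spM := normal_spanM IHA IHB.
by do 2![apply: NormalSpanSub => //]; apply: normal_spanD.
Qed.

Lemma integral_cone_normal_span (gT : finGroupType) (mu : gT -> nat) :
  integral_cone mu -> normal_span [ffun x => (mu x)%:R].
Proof.
case=> c cP muE.
have -> : [ffun x => (mu x)%:R] = \sum_(A : {set gT}) set_indicator A *+ c A.
  apply/ffunP=> x; rewrite sum_ffunE ffunE muE natr_sum.
  by apply: eq_bigr => A _; rewrite ffunMnE ffunE mulnC natrM mulr_natr.
apply: big_ind => [|f g|A _]; [exact: normal_span0 | exact: normal_spanD |].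
have [-> | /cP[algA _ _]] := eqVneq (c A) 0%N; first exact: normal_span0.
elim: (c A) => [|n IHn]; first exact: normal_span0.
by rewrite mulrS; apply: normal_spanD IHn; apply: normal_algebra_span.
Qed.

Lemma cayley_mxB (F : fieldType) (gT : finGroupType) (f g : {ffun gT -> int}) :
  cayley_mx F (f - g) = cayley_mx F f - cayley_mx F g.
Proof. by apply/matrixP=> i j; rewrite !mxE !ffunE rmorphB. Qed.

Lemma cayley_mx1 (F : fieldType) (gT : finGroupType) :
  cayley_mx F (set_indicator [1 gT]) = 1%:M.
Proof.
apply/matrixP=> i j; rewrite !mxE ffunE inE -eq_mulgV1.
by rewrite (inj_eq enum_val_inj); case: (i == j).
Qed.

Lemma card_rcosetI (gT : finGroupType) (N M : {group gT}) (x z : gT) :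
  #|N :* x :&: M :* z| = (#|N :&: M| * (x * z^-1 \in N * M)%g)%N.
Proof.
have [/mulsgP[a b Na Mb xzE] | nNM] := boolP (x * z^-1 \in N * M)%g; last first.
  rewrite muln0; apply/eqP; rewrite cards_eq0; apply: contraNT nNM.
  case/set0Pn=> y /setIP[]; rewrite !mem_rcoset => Nyx Myz.
  apply/mulsgP; exists (x * y^-1)%g (y * z^-1)%g => //.
    by rewrite -groupV invMg invgK.
  by rewrite mulgA mulgKV.
(* With x z^-1 = a b, the two cosets meet at a^-1 x = b z. *)
have bzE : (b * z = a^-1 * x)%g.
  by apply: (mulgI a); rewrite mulKVg mulgA -xzE mulgKV.
have -> : N :* x = N :* (b * z) by rewrite bzE rcosetM (rcoset_id (groupVr Na)).
have -> : M :* z = M :* (b * z) by rewrite rcosetM (rcoset_id Mb).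
by rewrite muln1 -(card_rcoset (N :&: M) (b * z)) /rcoset; congr #|pred_of_set _|;
  apply/setP=> y; rewrite !inE !mem_rcoset inE.
Qed.

(** The entry of the product at [(x, z)] counts the [y] with [x y^-1] in [N] and
    [y z^-1] in [M], that is, the intersection of the cosets [N x] and [M z]. *)
Lemma cayley_mxM (F : fieldType) (gT : finGroupType) (N M : {group gT}) :
  cayley_mx F (set_indicator N) *m cayley_mx F (set_indicator M)
  = #|N :&: M|%:R *: cayley_mx F (set_indicator (N * M)%g).
Proof.
apply/matrixP=> i j; rewrite !mxE ffunE.
rewrite [in RHS]rmorph_nat -natrM -card_rcosetI -sum1_card natr_sum.
rewrite [RHS](reindex _ (onW_bij _ (@enum_val_bij gT))) [RHS]big_mkcond /=.
apply: eq_bigr => k _; rewrite !mxE !ffunE !inE !mem_rcoset.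
rewrite -[in RHS](groupV N) invMg invgK.
by do 2![case: (_ \in _)]; rewrite ?mulr1 ?mulr0 ?mul0r.
Qed.

(** Normality enters through [N * M = M * N]. *)
Lemma cayley_mx_comm (F : fieldType) (gT : finGroupType) (N : {group gT})
    (f : {ffun gT -> int}) :
  N <| [set: gT] -> normal_span f ->
  cayley_mx F f *m cayley_mx F (set_indicator N)
  = cayley_mx F (set_indicator N) *m cayley_mx F f.
Proof.
move=> nN; elim=> {f} [M nM | f g _ IHf _ IHg]; last first.
  by rewrite cayley_mxB mulmxBl mulmxBr IHf IHg.
rewrite !cayley_mxM setIC normC //.
exact: subset_trans (subsetT M) (normal_norm nN).
Qed.

(** The maximality of [N] turns [v J_N] into an eigenvector of all the [J_M] at
    once: where [M] is not inside [N], the product [NM] is a larger normal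
    subgroup, which kills [v]. *)
Lemma maximal_common_eigenvector (F : fieldType) (gT : finGroupType)
    (v : 'rV[F]_#|gT|) (N : {group gT}) (f : {ffun gT -> int}) :
  maxgroup N (fun M : {group gT} =>
    (M <| [set: gT]) && (v *m cayley_mx F (set_indicator M) != 0)) ->
  normal_span f ->
  exists z : int,
    v *m cayley_mx F (set_indicator N) *m cayley_mx F f
    = z%:~R *: (v *m cayley_mx F (set_indicator N)).
Proof.
case/maxgroupP=> /andP[nN _] maxN.
elim=> {f} [M nM | f g _ [y IHf] _ [z IHg]]; last first.
  by exists (y - z); rewrite cayley_mxB mulmxBr IHf IHg -scalerBl rmorphB.
rewrite -mulmxA cayley_mxM -scalemxAr.
have NMnorm : N \subset 'N(M) := subset_trans (subsetT N) (normal_norm nM).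
have [sMN | nsMN] := boolP (M \subset N).
  by exists #|M|%:R; rewrite rmorph_nat (setIidPr sMN) mulGSid.
exists 0; rewrite scale0r -norm_joinEl //.
have [-> | vNM] := eqVneq (v *m cayley_mx F (set_indicator (N <*> M))) 0.
  by rewrite scaler0.
case/negP: nsMN; rewrite -(maxN (N <*> M)%G) ?joing_subr ?joing_subl //.
by rewrite vNM normalY.
Qed.

Lemma normal_span_eigenvalue_int (F : fieldType) (gT : finGroupType)
    (f : {ffun gT -> int}) (a : F) :
  normal_span f -> eigenvalue (cayley_mx F f) a -> exists z : int, a = z%:~R.
Proof.
move=> spf /eigenvalueP[v va nzv].
pose survives (M : {group gT}) :=
  (M <| [set: gT]) && (v *m cayley_mx F (set_indicator M) != 0).
have survives1 : survives 1%G.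
  by rewrite /survives normal1 cayley_mx1 mulmx1.
have [N maxN _] := maxgroup_exists survives1.
have [/andP[nN nzw] _] := maxgroupP maxN.
have [z wz] := maximal_common_eigenvector maxN spf; exists z.
move: wz; rewrite -mulmxA -cayley_mx_comm // mulmxA va -scalemxAl => /eqP.
by rewrite -subr_eq0 -scalerBl scaler_eq0 (negPf nzw) orbF subr_eq0 => /eqP.
Qed.

Theorem theorem2 (C : numClosedFieldType) (gT : finGroupType) (mu : gT -> nat)
    (hmu : integral_cone mu) : integral_cayley C mu.
Proof.
have adjE : cayley_adjacency C mu = cayley_mx C [ffun x => (mu x)%:R].
  by apply/matrixP=> i j; rewrite !mxE ffunE rmorph_nat.
move=> a; rewrite adjE; apply: normal_span_eigenvalue_int.
exact: integral_cone_normal_span.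
Qed.
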